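(* Let $Q$ be a finite $n$-nicely-graded bound quiver. Then there is a sequence $Q(0)=Q,Q(1),\dots,Q(t),\dots$ of nicely-graded bound quivers such that for every $t\ge0$: (1) $Q(t+1)=\widehat{Q(t)}$ is the multi-layer quiver of $Q(t)$; (2) $Q(t)$ is an $(n+t)$-nicely-graded quiver.
   Context: $k$ is a field. Bound quivers have relations that are linear combinations of paths of equal length $\ge2$ with common source and target; paths composed right to left; $s(p),t(p),l(p)$ are source, target, length; bound paths are nonzero in $\Lambda=kQ/(\rho)$. $Q$ is $m$-properly-graded if all maximal bound paths have length $m$; nicely-graded if there is $u:Q_0\to\mathbb Z$ with $u(j)=u(i)+1$ for each arrow $i\to j$ (equivalently every cyclic walk has zero grade); $m$-nicely-graded if both. Multi-layer quiver of a finite $m$-nicely-graded $Q$ (with a fixed basis $\mathcal M$ of $\Lambda_m$ of images of maximal bound paths, dual functionals $f^*\in D\Lambda$ vanishing off degree $m$, $D\Lambda$ a bimodule via $(a\varphi b)(x)=\varphi(bxa)$, and $\rho_{\mathcal M}$ the set of combinations $\sum_fc_fx_f\beta_fy_f$ of paths with $\sum_f c_fx_ff^*y_f=0$): vertices $(i,r)$, $i\in Q_0$, $0\le r\le m+1$; arrows $\alpha^{[r]}:(i,r)\to(j,r)$ for arrows $\alpha:i\to j$; $\gamma_i^{[r]}:(i,r)\to(i,r+1)$, $0\le r\le m$; $\beta_p:(t(p),0)\to(s(p),m+1)$, $p\in\mathcal M$. Relations: copies of $\rho$ on each floor; $\gamma_i^{[r+1]}\gamma_i^{[r]}$ ($0\le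 r\le m-1$); $\alpha^{[r+1]}\gamma_i^{[r]}-\gamma_j^{[r]}\alpha^{[r]}$ ($0\le r\le m$); $\sum_fc_fx_f^{[m+1]}\beta_fy_f^{[0]}$ for elements of $\rho_{\mathcal M}$. *)

(* Defs.v *)
From HB Require Import structures.
From mathcomp Require Import all_boot all_order all_algebra.
Unset Printing Implicit Defensive.
Import GRing.Theory.
Local Open Scope ring_scope.

(** * Bound quivers over a field [k].
    A (finite) quiver has a finite vertex type and a finite arrow type.
    A path is a pair (starting vertex, list of arrows in the order in which
    they are traversed); thus the path written [a_l ... a_1] (composition
    right to left) is represented by [(s(a_1), [:: a_1; ...; a_l])].
    An element of the path algebra kQ is represented by a finite formal
    linear combination [seq (coefficient, path)]; two such lists denote the
    same element iff they have the same coefficient function [coef].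
    The relations form an arbitrary (possibly infinite) set of elements. *)
Record bquiver (k : fieldType) := BQuiver {
  qV : finType;
  qA : finType;
  qs : qA -> qV;
  qt : qA -> qV;
  qrel : seq (k * (qV * seq qA)) -> Prop }.

Arguments qV {k} b.
Arguments qA {k} b.
Arguments qs {k b} _.
Arguments qt {k b} _.
Arguments qrel {k} b _.
Arguments BQuiver {k} qV qA qs qt qrel.

Section Paths.
Variables (k : fieldType) (Q : bquiver k).

Definition qpath := (qV Q * seq (qA Q))%type.
Definition kQ := seq (k * qpath).

Definition ptgt (p : qpath) : qV Q := last p.1 (map (qt) p.2).

Fixpoint chain (v : qV Q) (l : seq (qA Q)) : bool :=
  if l is a :: l' then (qs a == v) && chain (qt a) l' else true.
Definition is_path (p : qpath) : bool := chain p.1 p.2.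

Definition plen (p : qpath) : nat := size p.2.

Definition coef (x : kQ) (p : qpath) : k := \sum_(u <- x | u.2 == p) u.1.

(* the product c * u * r * v  (v traversed first, then r, then u) *)
Definition sandwich (c : k) (u : qpath) (r : kQ) (v : qpath) : kQ :=
  [seq (c * a.1, (v.1, v.2 ++ a.2.2 ++ u.2))
     | a <- r & (ptgt v == a.2.1) && (ptgt a.2 == u.1)].

Definition in_ideal (x : kQ) : Prop :=
  exists T : seq (k * qpath * kQ * qpath),
    (forall w, w \in T ->
       [/\ qrel Q w.1.2, is_path w.1.1.2 & is_path w.2]) /\
    forall p, coef x p =
      coef (flatten [seq sandwich w.1.1.1 w.1.1.2 w.1.2 w.2 | w <- T]) p.

Definition bound_path (p : qpath) : Prop :=
  is_path p /\ ~ in_ideal [:: (1, p)].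

Definition maximal_bound_path (p : qpath) : Prop :=
  bound_path p /\
  forall (q : qpath) (l1 l2 : seq (qA Q)),
    bound_path q -> q.2 = l1 ++ p.2 ++ l2 ->
    last q.1 (map (qt) l1) = p.1 ->
    l1 = [::] /\ l2 = [::].

Definition is_bound_quiver : Prop :=
  forall r, qrel Q r ->
    exists (s t : qV Q) (L : nat), (2 <= L)%N /\
      forall p, coef r p != 0 ->
        [/\ is_path p, p.1 = s, ptgt p = t & plen p = L].

Definition properly_graded (m : nat) : Prop :=
  forall p, maximal_bound_path p -> plen p = m.

Definition nicely_graded : Prop :=
  exists u : qV Q -> int, forall a : qA Q, u (qt a) = u (qs a) + 1.

Definition nicely_graded_m (m : nat) : Prop :=
  properly_graded m /\ nicely_graded.

Definition Mth (M : seq qpath) (i : 'I_(size M)) : qpath := tnth (in_tuple M) i.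

(* phi i is the dual functional (M_i)^* on paths: it vanishes off degree m,
   and on (valid) paths z of degree m gives the coordinates of z in the
   basis M of Lambda_m. *)
Definition is_dual (m : nat) (M : seq qpath) (phi : 'I_(size M) -> qpath -> k)
  : Prop :=
  (forall z, is_path z -> plen z = m ->
     in_ideal ((1, z) :: [seq (- phi i z, Mth M i) | i <- enum 'I_(size M)])) /\
  (forall z, is_path z -> plen z <> m -> forall i, phi i z = 0).

Definition ml_basis (m : nat) (M : seq qpath) : Prop :=
  (forall i, maximal_bound_path (Mth M i) /\ plen (Mth M i) = m) /\
  (* spanning *)
  (exists phi, is_dual m M phi) /\
  (forall a : 'I_(size M) -> k,
     in_ideal [seq (a i, Mth M i) | i <- enum 'I_(size M)] -> forall i, a i = 0).

End Paths.

Arguments qpath {k} Q.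
Arguments kQ {k} Q.
Arguments ptgt {k Q} p.
Arguments chain {k Q} v l.
Arguments is_path {k Q} p.
Arguments plen {k Q} p.
Arguments coef {k Q} x p.
Arguments sandwich {k Q} c u r v.
Arguments in_ideal {k} Q x.
Arguments bound_path {k} Q p.
Arguments maximal_bound_path {k} Q p.
Arguments is_bound_quiver {k} Q.
Arguments properly_graded {k} Q m.
Arguments nicely_graded {k} Q.
Arguments nicely_graded_m {k} Q m.
Arguments Mth {k Q} M i.
Arguments is_dual {k} Q m M phi.
Arguments ml_basis {k} Q m M.


Section MultiLayer.
Variables (k : fieldType) (Q : bquiver k) (m : nat) (M : seq (qpath Q)).

Definition mlV : finType := (qV Q * 'I_m.+2)%type.
Definition mlA : finType :=
  ((qA Q * 'I_m.+2) + (qV Q * 'I_m.+1) + 'I_(size M))%type.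

Definition wid (r : 'I_m.+1) : 'I_m.+2 := widen_ord (leqnSn _) r.
Definition suc (r : 'I_m.+1) : 'I_m.+2 := lift ord0 r.

Definition mls (b : mlA) : mlV :=
  match b with
  | inl (inl (a, r)) => (qs a, r)
  | inl (inr (i, r)) => (i, wid r)
  | inr j => (ptgt (Mth M j), ord0)
  end.

Definition mlt (b : mlA) : mlV :=
  match b with
  | inl (inl (a, r)) => (qt a, r)
  | inl (inr (i, r)) => (i, suc r)
  | inr j => ((Mth M j).1, ord_max)
  end.

Definition alpha (a : qA Q) (r : 'I_m.+2) : mlA := inl (inl (a, r)).
Definition gamma (i : qV Q) (r : 'I_m.+1) : mlA := inl (inr (i, r)).
Definition beta (j : 'I_(size M)) : mlA := inr j.

Definition floor (r : 'I_m.+2) (p : qpath Q) : mlV * seq mlA :=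
  ((p.1, r), [seq alpha a r | a <- p.2]).

Definition xby (x : qpath Q) (j : 'I_(size M)) (y : qpath Q) : mlV * seq mlA :=
  ((y.1, ord0),
   [seq alpha a ord0 | a <- y.2] ++ beta j :: [seq alpha a ord_max | a <- x.2]).

Definition rhoM (rel : seq (k * (mlV * seq mlA))) : Prop :=
  exists T : seq (k * qpath Q * 'I_(size M) * qpath Q),
    [/\ (* each term is a path of the multi-layer quiver *)
        (forall w, w \in T ->
           [/\ is_path w.1.1.2, is_path w.2,
               ptgt w.2 = ptgt (Mth M w.1.2) & w.1.1.2.1 = (Mth M w.1.2).1]),
        (exists (s t : qV Q) (L : nat), forall w, w \in T ->
           [/\ w.2.1 = s, ptgt w.1.1.2 = t & plen w.1.1.2 + plen w.2 = L]%N),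
        (* sum_f c_f x_f f^* y_f = 0 in D Lambda, tested on all paths z *)
        (forall phi, is_dual Q m M phi -> forall z, is_path z ->
           \sum_(w <- T)
              w.1.1.1 * (if (ptgt w.1.1.2 == z.1) && (ptgt z == w.2.1)
                         then phi w.1.2 (w.1.1.2.1, w.1.1.2.2 ++ z.2 ++ w.2.2)
                         else 0) = 0) &
        rel = [seq (w.1.1.1, xby w.1.1.2 w.1.2 w.2) | w <- T]].

Definition mlrel (rel : seq (k * (mlV * seq mlA))) : Prop :=
  (exists (r : 'I_m.+2) (x : kQ Q),
      qrel Q x /\ rel = [seq (u.1, floor r u.2) | u <- x]) \/
  (exists (i : qV Q) (r : 'I_m),
      rel = [:: (1, ((i, wid (widen_ord (leqnSn _) r)),
                     [:: gamma i (widen_ord (leqnSn _) r); gamma i (lift ord0 r)]))]) \/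
  (exists (a : qA Q) (r : 'I_m.+1),
      rel = [:: (1, ((qs a, wid r), [:: gamma (qs a) r; alpha a (suc r)]));
                (-1, ((qs a, wid r), [:: alpha a (wid r); gamma (qt a) r]))]) \/
  rhoM rel.

Definition multilayer : bquiver k := BQuiver mlV mlA mls mlt mlrel.

End MultiLayer.
Arguments multilayer {k} Q m M.

(* Main.v *)
(** Modulo its ideal, the path algebra of the multi-layer quiver is the sum of
    the copies of [Lambda] on the floors, of the spaces [Lambda gamma] between
    consecutive floors, and of [D Lambda], spanned by the paths [x beta_f y].
    A path containing two vertical arrows vanishes, because vertical arrows
    commute with horizontal ones.  A bound floor path is never maximal, since
    a vertical arrow extends it; a path with one vertical arrow is maximal
    only if its projection to [Q] is, so it has length [m + 1]; and if
    [x f^* y] is nonzero on [z], then [x beta_f y] extends along [z] to a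
    nonzero path of length [m + 1].  Nonvanishing is detected by a projection
    sending the ideal into that of [Q], and by the functional
    [x beta_f y |-> f^*(yx)]. *)
Require Import Defs.
From mathcomp Require Import all_boot all_order all_algebra.
From Stdlib Require Import Classical ClassicalEpsilon.
Set Implicit Arguments.
Unset Strict Implicit.
Unset Printing Implicit Defensive.
Import GRing.Theory.
Local Open Scope ring_scope.

(** * Linear functionals and linear maps on formal combinations of paths *)

Definition ev (k : fieldType) (Q : bquiver k) (f : qpath Q -> k) (x : kQ Q) : k :=
  \sum_(u <- x) u.1 * f u.2.

Definition lin (k : fieldType) (Q Q' : bquiver k) (F : qpath Q -> kQ Q')
    (x : kQ Q) : kQ Q' :=
  flatten [seq [seq (u.1 * v.1, v.2) | v <- F u.2] | u <- x].

Section Combinations.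
Variables (k : fieldType) (Q : bquiver k).
Implicit Types (f g : qpath Q -> k) (x y : kQ Q) (p q : qpath Q).

Lemma ev_nil f : ev f [::] = 0.
Proof. exact: big_nil. Qed.

Lemma ev_cons f u x : ev f (u :: x) = u.1 * f u.2 + ev f x.
Proof. exact: big_cons. Qed.

Lemma ev_cat f x y : ev f (x ++ y) = ev f x + ev f y.
Proof. exact: big_cat. Qed.

Lemma eq_evr f g x : f =1 g -> ev f x = ev g x.
Proof. by move=> fg; apply: eq_bigr => u _; rewrite fg. Qed.

Lemma ev0 x : ev (fun=> 0) x = 0.
Proof. by rewrite /ev big1 // => u _; rewrite mulr0. Qed.

Lemma ev_mull c f x : ev (fun p => c * f p) x = c * ev f x.
Proof. by rewrite /ev big_distrr; apply: eq_bigr => u _; rewrite mulrCA. Qed.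

Lemma coefE x p : coef x p = ev (fun q => (q == p)%:R) x.
Proof.
rewrite /coef /ev big_mkcond; apply: eq_bigr => u _.
by case: eqP => _; rewrite ?mulr1 ?mulr0.
Qed.

(** Regroup the terms path by path. The list [s] may exceed the support, so that two combinations
    can be compared over one common list. *)
Lemma ev_coef f x (s : seq (qpath Q)) : uniq s ->
  {subset [seq u.2 | u <- x] <= s} -> ev f x = \sum_(p <- s) coef x p * f p.
Proof.
move=> us xs; under eq_bigr => p _ do rewrite /coef big_mkcond big_distrl /=.
rewrite exchange_big /=; rewrite /ev big_seq [RHS]big_seq; apply: eq_bigr => u ux.
rewrite (bigD1_seq u.2) ?us ?xs ?map_f //= eqxx big1 ?addr0 // => p.
by rewrite eq_sym => /negbTE ->; rewrite mul0r.
Qed.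

Lemma eq_ev f x y : coef x =1 coef y -> ev f x = ev f y.
Proof.
move=> xy; pose s := undup ([seq u.2 | u <- x] ++ [seq u.2 | u <- y]).
rewrite (@ev_coef f x s) ?(@ev_coef f y s) ?undup_uniq //.
- by apply: eq_bigr => p _; rewrite xy.
- by move=> p py; rewrite mem_undup mem_cat py orbT.
- by move=> p py; rewrite mem_undup mem_cat py.
Qed.

Lemma eq_ev_supp f g x :
  (forall p, coef x p != 0 -> f p = g p) -> ev f x = ev g x.
Proof.
move=> fg; pose s := undup [seq u.2 | u <- x].
have xs : {subset [seq u.2 | u <- x] <= s} by move=> p; rewrite mem_undup.
rewrite (ev_coef f (undup_uniq _) xs) (ev_coef g (undup_uniq _) xs).
apply: eq_bigr => p _; have [->|/fg ->//] := eqVneq (coef x p) 0.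
by rewrite !mul0r.
Qed.

Lemma ev_supp0 f x : (forall p, coef x p != 0 -> f p = 0) -> ev f x = 0.
Proof. by move=> f0; rewrite (eq_ev_supp f0) ev0. Qed.

Lemma ev_neq0 f x : ev f x != 0 -> exists2 p, coef x p != 0 & f p != 0.
Proof.
move=> nz; apply: NNPP => nex; case/eqP: nz; apply: ev_supp0 => p xp.
by apply: NNPP => /eqP fp; apply: nex; exists p.
Qed.

Lemma ev_scale f c x : ev f [seq (c * u.1, u.2) | u <- x] = c * ev f x.
Proof.
by rewrite /ev big_map big_distrr /=; apply: eq_bigr => u _; rewrite mulrA.
Qed.

Lemma ev_sandwich f c (u v : qpath Q) x :
  ev f (sandwich c u x v) =
  c * ev (fun a => if (ptgt v == a.1) && (ptgt a == u.1)
                   then f (v.1, v.2 ++ a.2 ++ u.2) else 0) x.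
Proof.
rewrite /ev /sandwich big_map big_filter big_mkcond big_distrr /=.
by apply: eq_bigr => a _; case: ifP; rewrite ?mulr0 ?mulrA.
Qed.

Lemma in_ideal_ext x y : coef x =1 coef y -> in_ideal Q x -> in_ideal Q y.
Proof. by move=> xy [T [T1 T2]]; exists T; split=> // p; rewrite -xy. Qed.

Lemma in_ideal_coef0 x : (forall p, coef x p = 0) -> in_ideal Q x.
Proof.
by move=> x0; exists [::]; split=> // p; rewrite x0 /coef big_nil.
Qed.

Lemma in_ideal_cat x y : in_ideal Q x -> in_ideal Q y -> in_ideal Q (x ++ y).
Proof.
move=> [T [T1 T2]] [S [S1 S2]]; exists (T ++ S); split=> [w|p].
  by rewrite mem_cat => /orP[/T1|/S1].
by rewrite map_cat flatten_cat !coefE !ev_cat -!coefE T2 S2.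
Qed.

Lemma in_ideal_sandwich c (u v : qpath Q) x :
  qrel Q x -> is_path u -> is_path v -> in_ideal Q (sandwich c u x v).
Proof.
move=> xr pu pv; exists [:: (c, u, x, v)]; split=> [w|p] /=.
  by rewrite inE => /eqP->.
by rewrite cats0.
Qed.

Lemma in_ideal_ind (P : kQ Q -> Prop) :
  (forall x y, coef x =1 coef y -> P x -> P y) -> P [::] ->
  (forall x y, P x -> P y -> P (x ++ y)) ->
  (forall c (u v : qpath Q) x, qrel Q x -> is_path u -> is_path v ->
     P (sandwich c u x v)) ->
  forall x, in_ideal Q x -> P x.
Proof.
move=> Pext P0 Pcat Pgen x [T [T1 T2]].
apply: (Pext _ _ (fsym T2)) => {x T2}; elim: T T1 => [|w T IH] T1 //=.
apply: Pcat; last by apply: IH => w' w'T; apply: T1; rewrite inE w'T orbT.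
by have [] := T1 w (mem_head _ _); apply: Pgen.
Qed.

Lemma ev_ideal0 f :
  (forall c (u v : qpath Q) x, qrel Q x -> is_path u -> is_path v ->
     ev f (sandwich c u x v) = 0) ->
  forall x, in_ideal Q x -> ev f x = 0.
Proof.
move=> fgen; apply: in_ideal_ind => // [x y xy <-||x y].
- exact/esym/eq_ev.
- exact: ev_nil.
- by rewrite ev_cat => -> ->; rewrite addr0.
Qed.

Lemma in_ideal_scale c x :
  in_ideal Q x -> in_ideal Q [seq (c * u.1, u.2) | u <- x].
Proof.
move: x; apply: in_ideal_ind => [x y xy||x y xI yI|d u v x xr pu pv].
- by apply: in_ideal_ext => p; rewrite !coefE !ev_scale -!coefE xy.
- exact: in_ideal_coef0 (fun=> big_nil _ _ _ _).
- by rewrite map_cat; apply: in_ideal_cat.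
- apply: in_ideal_ext (in_ideal_sandwich (c * d) xr pu pv) => p.
  by rewrite !coefE ev_scale !ev_sandwich mulrA.
Qed.

(** Sandwich the relation between the trivial paths at its source and target; [sandwich] drops the
    terms with other ends, and here there are none. *)
Lemma in_ideal_qrel x (s t : qV Q) : qrel Q x ->
  (forall p, coef x p != 0 -> p.1 = s /\ ptgt p = t) -> in_ideal Q x.
Proof.
move=> xr st.
have := @in_ideal_sandwich 1 (t, [::]) (s, [::]) x xr isT isT.
apply: in_ideal_ext => p; rewrite !coefE ev_sandwich mul1r.
apply: eq_ev_supp => -[a l] /st /= [<- ->].
by rewrite /ptgt /= !eqxx cats0.
Qed.

Lemma chain_cat (v : qV Q) l1 l2 :
  chain v (l1 ++ l2) = chain v l1 && chain (last v (map qt l1)) l2.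
Proof. by elim: l1 v => //= a l IH v; rewrite IH andbA. Qed.

Lemma in_ideal_trans p q : 
  in_ideal Q [:: (1, p); (-1, q)] -> in_ideal Q [:: (1, q)] ->
  in_ideal Q [:: (1, p)].
Proof.
move=> pq qI; apply: in_ideal_ext (in_ideal_cat pq qI) => r.
by rewrite !coefE /ev !big_cons big_nil /= !mulN1r !mul1r !addr0 addNr addr0.
Qed.

End Combinations.

(** * Linear maps that respect the ideals *)

Section Lin.
Variables (k : fieldType) (Q Q' : bquiver k) (F : qpath Q -> kQ Q').

Lemma ev_lin (g : qpath Q' -> k) x : ev g (lin F x) = ev (fun q => ev g (F q)) x.
Proof.
elim: x => [|u x IH]; first by rewrite !ev_nil.
by rewrite ev_cons -IH /lin /= ev_cat ev_scale.
Qed.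

Lemma in_ideal_lin :
  (forall c (u v : qpath Q) x, qrel Q x -> is_path u -> is_path v ->
     in_ideal Q' (lin F (sandwich c u x v))) ->
  forall x, in_ideal Q x -> in_ideal Q' (lin F x).
Proof.
move=> Fgen; apply: in_ideal_ind => // [x y xy||x y xI yI].
- by apply: in_ideal_ext => p; rewrite !coefE !ev_lin; apply: eq_ev.
- exact: in_ideal_coef0 (fun=> big_nil _ _ _ _).
- apply: in_ideal_ext (in_ideal_cat xI yI) => p.
  by rewrite !coefE !ev_cat !ev_lin ev_cat.
Qed.

Lemma in_ideal_lin_supp x :
  (forall p, coef x p != 0 -> in_ideal Q' (F p)) -> in_ideal Q' (lin F x).
Proof.
(* [y] lists each path of nonzero coefficient once. The list [x] may also contain paths whose
   coefficients cancel, and for these nothing is known about [F]. *)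
move=> xF; pose y := [seq (coef x p, p) | p <- undup [seq u.2 | u <- x] & coef x p != 0].
have yx f : ev f y = ev f x.
  rewrite (@ev_coef _ _ f x _ (undup_uniq [seq u.2 | u <- x])).
    rewrite /ev big_map big_filter big_mkcond; apply: eq_bigr => p _.
    by case: eqP => //= ->; rewrite mul0r.
  by move=> p; rewrite mem_undup.
have: in_ideal Q' (lin F y).
  have: all (fun u => coef x u.2 != 0) y.
    by apply/allP => u /mapP[p]; rewrite mem_filter => /andP[? _] ->.
  elim: (y) => [|u z IH] /=; first by move=> _; exact: in_ideal_coef0 (fun=> big_nil _ _ _ _).
  by case/andP=> ux /IH zI; apply: in_ideal_cat zI; apply/in_ideal_scale/xF.
by apply: in_ideal_ext => p; rewrite !coefE !ev_lin.
Qed.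

End Lin.

(** * Lengths of bound paths, and bases of the top degree with their dual functionals *)

Section BoundQuiver.
Variables (k : fieldType) (Q : bquiver k).

Lemma coef_sandwich_path c (u v : qpath Q) x :
  is_bound_quiver Q -> qrel Q x -> is_path u -> is_path v ->
  exists L, forall p, coef (sandwich c u x v) p != 0 -> is_path p /\ plen p = L.
Proof.
move=> bQ xr pu pv; have [s [t [L [_ xL]]]] := bQ x xr.
exists (plen v + L + plen u)%N => p; rewrite coefE ev_sandwich => nz.
apply: NNPP => npath; case/eqP: nz; rewrite (ev_supp0) ?mulr0 // => a /xL[pa as_ ta la].
case: ifP => // /andP[/eqP va /eqP au]; case: eqP => // def_p; case: npath.
rewrite -def_p /is_path /plen /= !size_cat -la addnA; split=> //.
rewrite !chain_cat -/(ptgt v) va.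
by apply/and3P; split=> //; rewrite -/(ptgt a) au.
Qed.

Lemma path_grade (u : qV Q -> int) :
  (forall a : qA Q, u (qt a) = u (qs a) + 1) ->
  forall p : qpath Q, is_path p -> u (ptgt p) = u p.1 + (plen p)%:Z.
Proof.
move=> uQ [v l]; rewrite /is_path /ptgt /plen /=.
elim: l v => [|a l IH] v /=; first by rewrite addr0.
by case/andP=> /eqP <- /IH ->; rewrite uQ -addrA -intS.
Qed.

(** The length of a path is the difference of the grades of its ends, and there are finitely many
    pairs of vertices. *)
Lemma plen_bounded : nicely_graded Q ->
  exists B, forall p : qpath Q, is_path p -> (plen p <= B)%N.
Proof.
case=> u uQ; exists (\max_(vw : qV Q * qV Q) `|u vw.2 - u vw.1|)%N => p pp.
rewrite -[plen p]/(`|Posz (plen p)|)%N.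
have ->: (plen p)%:Z = u (ptgt p) - u p.1 by rewrite (path_grade uQ pp) addrC addKr.
exact: (@leq_bigmax _ (fun vw : qV Q * qV Q => `|u vw.2 - u vw.1|%N) (p.1, ptgt p)).
Qed.

(** A bound path that is not maximal lies in a strictly longer one. As lengths are bounded by [B],
    induction on [B - plen p] leads to a maximal path, which has length [m]. *)
Lemma bound_path_le m (p : qpath Q) :
  nicely_graded_m Q m -> bound_path Q p -> (plen p <= m)%N.
Proof.
case=> prQ /plen_bounded[B lB] bp.
have [N] := ubnP (B - plen p)%N; elim: N p bp => // N IH p bp lN.
have [mp|nmp] := classic (maximal_bound_path Q p); first by rewrite (prQ p mp).
apply: NNPP => lpm; apply: nmp; split=> // q l1 l2 bq ql pl.
have lq: plen q = (size l1 + plen p + size l2)%N by rewrite /plen ql !size_cat addnA.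
apply: NNPP => l12; apply: lpm.
have l12_gt0 : (0 < size l1 + size l2)%N.
  by rewrite lt0n addn_eq0; apply/negP => /andP[/nilP e1 /nilP e2]; apply: l12.
have lt_pq : (plen p < plen q)%N by rewrite lq addnAC -[ltnLHS]add0n ltn_add2r.
apply: leq_trans (ltnW lt_pq) (IH q bq _); rewrite -ltnS.
apply: leq_trans lN; rewrite ltnS; apply: ltn_sub2l => //.
by apply: leq_trans lt_pq _; apply: lB; case: bq.
Qed.

Lemma maximal_of_plen m (p : qpath Q) :
  nicely_graded_m Q m -> bound_path Q p -> plen p = m -> maximal_bound_path Q p.
Proof.
move=> gQ bp lp; split=> // q l1 l2 /(bound_path_le gQ).
rewrite -{}lp /plen => lq ql _; move: lq; rewrite ql !size_cat.
rewrite addnCA -[leqRHS]addn0 leq_add2l leqn0 addn_eq0.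
by case/andP=> /nilP -> /nilP ->.
Qed.

Definition comb (M : seq (qpath Q)) (a : 'I_(size M) -> k) : kQ Q :=
  [seq (a i, Mth M i) | i <- enum 'I_(size M)].

Lemma ev_comb f M (a : 'I_(size M) -> k) :
  ev f (comb a) = \sum_i a i * f (Mth M i).
Proof. by rewrite /ev big_map big_enum. Qed.

(** This makes [phi i] well defined on the quotient by the ideal. In degree [m], subtracting from
    [x] the elements that rewrite each of its paths in the basis leaves the combination of the
    [Mth M i] with coefficients [ev (phi i) x]; independence kills it. *)
Lemma dual_ideal m M phi x L i :
  (forall a : 'I_(size M) -> k, in_ideal Q (comb a) -> forall i, a i = 0) ->
  is_dual Q m M phi ->
  (forall p, coef x p != 0 -> is_path p /\ plen p = L) ->
  in_ideal Q x -> ev (phi i) x = 0.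
Proof.
move=> indep [dual dual0] xL xI; have [defL|neL] := eqVneq L m; last first.
  by apply: ev_supp0 => p /xL[pp pL]; apply: dual0; rewrite // pL; apply/eqP.
apply: (indep (fun i => ev (phi i) x)).
pose F z : kQ Q := (1, z) :: comb (fun i => - phi i z).
have FI : in_ideal Q (lin F x).
  by apply: in_ideal_lin_supp => p /xL[pp pL]; apply: dual; rewrite // pL.
apply: in_ideal_ext (in_ideal_cat xI (in_ideal_scale (-1) FI)) => p.
rewrite !coefE ev_cat ev_scale ev_lin ev_comb mulN1r.
under [X in _ - X]eq_evr => z do rewrite /F ev_cons ev_comb mul1r /=.
rewrite /ev; under [X in _ - X]eq_bigr => z _ do rewrite mulrDr.
rewrite big_split /= opprD addNKr -sumrN.
under [RHS]eq_bigr => j _ do rewrite big_distrl.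
rewrite exchange_big /=; apply: eq_bigr => z _; rewrite -mulrN -sumrN big_distrr /=.
by apply: eq_bigr => j _; rewrite mulNr opprK mulrA.
Qed.

Lemma dual_basis m M phi i j :
  (forall a : 'I_(size M) -> k, in_ideal Q (comb a) -> forall i, a i = 0) ->
  is_dual Q m M phi -> is_path (Mth M j) -> plen (Mth M j) = m ->
  phi i (Mth M j) = (i == j)%:R.
Proof.
move=> indep [dual _] pj lj; have dI := dual _ pj lj.
apply/eqP; rewrite -subr_eq0 -oppr_eq0 opprB; apply/eqP.
apply: (indep (fun i => (i == j)%:R - phi i (Mth M j))); apply: in_ideal_ext dI => p.
rewrite !coefE ev_cons -/(comb (fun i => - phi i (Mth M j))) !ev_comb /=.
under [RHS]eq_bigr => l _ do rewrite mulrDl.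
rewrite big_split /=; congr (_ + _).
rewrite (bigD1 j) //= eqxx big1 ?addr0 // => l /negbTE->.
by rewrite mul0r.
Qed.

(** Greedy extraction: a path of [s] is kept exactly when it is not a combination, modulo the ideal,
    of the paths kept so far. *)
Lemma basis_exists (s : seq (qpath Q)) :
  exists M : seq (qpath Q),
  [/\ {subset M <= s},
      forall a : 'I_(size M) -> k, in_ideal Q (comb a) -> forall i, a i = 0 &
      forall z, z \in s -> exists a : 'I_(size M) -> k,
        in_ideal Q ((1, z) :: comb (fun i => - a i))].
Proof.
elim: s => [|z s [M [Ms indep span]]].
  by exists [::]; split=> // a _ [].
have [[a zI]|nspan] := classic (exists a : 'I_(size M) -> k,
        in_ideal Q ((1, z) :: comb (fun i => - a i))).
  exists M; split=> // [y /Ms ys|y]; first by rewrite inE ys orbT.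
  by rewrite inE => /predU1P[->|/span //]; exists a.
have comb_cons (a : 'I_(size (z :: M)) -> k) :
    comb a = (a ord0, z) :: comb (fun i : 'I_(size M) => a (lift ord0 i)).
  rewrite /comb enum_ordSl /= -map_comp; congr (_ :: _).
  by apply: eq_map => i /=; congr (_, _); rewrite /Mth !(tnth_nth z).
exists (z :: M); split=> [y|a|y].
- by rewrite !inE => /predU1P[->|/Ms->]; rewrite ?eqxx ?orbT.
- rewrite comb_cons => aI.
  (* A nonzero coefficient of [z] could be inverted, which would put [z] in the span of [M]. *)
  have a0 : a ord0 = 0.
    apply: NNPP => /eqP a0; apply: nspan.
    exists (fun i => - ((a ord0)^-1 * a (lift ord0 i))).
    apply: in_ideal_ext (in_ideal_scale (a ord0)^-1 aI) => p.
    rewrite !coefE ev_scale !ev_cons !ev_comb /= mulrDr mulrA mulVf //; congr (_ + _).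
    by rewrite big_distrr /=; apply: eq_bigr => i _; rewrite opprK mulrA.
  move=> i; case: (unliftP ord0 i) => [j|] -> //.
  apply: (indep (fun i => a (lift ord0 i))); apply: in_ideal_ext aI => p.
  by rewrite !coefE ev_cons a0 mul0r add0r.
- rewrite inE => /predU1P[->|ys].
    exists (fun i => if unlift ord0 i is Some _ then 0 else 1).
    rewrite comb_cons unlift_none; apply: in_ideal_coef0 => p.
    rewrite coefE !ev_cons ev_comb big1; first by rewrite addr0 mul1r mulN1r subrr.
    by move=> i _; rewrite liftK oppr0 mul0r.
  have [a aI] := span y ys.
  exists (fun i => if unlift ord0 i is Some j then a j else 0).
  rewrite comb_cons unlift_none; apply: in_ideal_ext aI => p.
  rewrite !coefE !ev_cons !ev_comb oppr0 mul0r add0r; congr (_ + _).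
  by apply: eq_bigr => i _; rewrite liftK.
Qed.

Lemma ml_basis_exists m : nicely_graded_m Q m -> exists M, ml_basis Q m M.
Proof.
move=> gQ.
(* There are finitely many paths of length [m]: each is a vertex with an [m]-tuple of arrows. *)
pose s := [seq p <- [seq (vt.1, tval vt.2) | vt <- enum {: qV Q * m.-tuple (qA Q)}]
             | is_path p].
have mem_s (z : qpath Q) : is_path z -> plen z = m -> z \in s.
  case: z => v l pz /eqP lz; rewrite mem_filter pz; apply/mapP.
  by exists (v, Tuple lz); rewrite ?mem_enum.
have [M [Ms indep span]] := basis_exists s.
have MP i : is_path (Mth M i) /\ plen (Mth M i) = m.
  have: Mth M i \in s by apply: Ms; apply: mem_tnth.
  rewrite mem_filter => /andP[? /mapP[vt _ def_i]]; split=> //.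
  by rewrite def_i /plen /= size_tuple.
exists M; split; [move=> i | split => //].
- have [pi li] := MP i; split=> //; apply: (maximal_of_plen gQ) => //; split=> // MI.
  (* A basis path in the ideal would be a dependence with single coefficient 1. *)
  have: (i == i)%:R = 0 :> k.
    apply: (indep (fun j => (j == i)%:R)); apply: in_ideal_ext MI => p.
    rewrite !coefE ev_comb ev_cons ev_nil addr0 (bigD1 i) //= eqxx big1 ?addr0 //.
    by move=> j /negbTE ->; rewrite mul0r.
  by move/eqP; rewrite eqxx oner_eq0.
- have coordP (z : qpath Q) : exists a : 'I_(size M) -> k,
      is_path z -> plen z = m -> in_ideal Q ((1, z) :: comb (fun i => - a i)).
    have [zs|zs] := boolP (z \in s).
      by have [a aI] := span z zs; exists a.
    by exists (fun=> 0) => pz lz; case/negP: zs; apply: mem_s.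
  pose coord z := proj1_sig (constructive_indefinite_description _ (coordP z)).
  have coord_spec z : is_path z -> plen z = m ->
      in_ideal Q ((1, z) :: comb (fun i => - coord z i)).
    by rewrite /coord; case: constructive_indefinite_description.
  (* The coordinates are cut off to 0 outside degree [m], as [is_dual] demands. *)
  exists (fun i z => if plen z == m then coord z i else 0); split=> z pz lz.
    by rewrite lz eqxx; apply: coord_spec.
  by move/eqP/negbTE: lz => ->.
Qed.

End BoundQuiver.

(** * Paths of the multi-layer quiver, their projection to [Q], and commutation of vertical
    arrows *)

Section MultiLayerTheory.
Variables (k : fieldType) (Q : bquiver k) (m : nat) (M : seq (qpath Q)).

Local Notation H := (multilayer Q m M).
Local Notation alpha := (alpha k Q m M).
Local Notation gamma := (gamma k Q m M).
Local Notation beta := (beta k Q m M).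
Local Notation wid := (wid m).
Local Notation suc := (suc m).
Local Notation top := (@ord_max m.+1).

Definition lift_seq (r : 'I_m.+2) (l : seq (qA Q)) : seq (qA H) :=
  [seq alpha a r | a <- l].
Local Notation "l ^[ r ]" := (lift_seq r l) (at level 2, format "l ^[ r ]").

Lemma lift_seq_cat r l1 l2 : (l1 ++ l2)^[r] = l1^[r] ++ l2^[r].
Proof. exact: map_cat. Qed.

Lemma last_lift (v : qV Q) r l :
  last ((v, r) : qV H) (map qt l^[r]) = (last v (map qt l), r).
Proof. by elim: l v => //= a l IH v; rewrite -IH. Qed.

Lemma ptgt_lift (v : qV Q) r l :
  ptgt (((v, r), l^[r]) : qpath H) = (last v (map qt l), r).
Proof. exact: last_lift. Qed.

Lemma pair_eqE (v w : qV Q) (r s : 'I_m.+2) :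
  (((v, r) : qV H) == (w, s)) = (v == w) && (r == s).
Proof. by []. Qed.

Lemma chain_lift (v : qV Q) r l : chain ((v, r) : qV H) l^[r] = chain v l.
Proof. by elim: l v => //= a l IH v; rewrite pair_eqE eqxx andbT IH. Qed.

(** Split at the first arrow that is not horizontal. A [beta] ends on the top floor, where no [beta]
    or [gamma] starts, so only horizontal arrows follow it; after a [gamma] the tail is left
    arbitrary. *)
Lemma multilayer_path_cases (v : qV Q) r (l : seq (qA H)) :
  chain ((v, r) : qV H) l ->
  [\/ exists2 a, l = a^[r] & chain v a,
      exists y j x, [/\ r = ord0, l = y^[ord0] ++ beta j :: x^[top], chain v y,
        last v (map qt y) = ptgt (Mth M j) & chain (Mth M j).1 x] |
      exists a (s : 'I_m.+1) l', [/\ r = wid s,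
        l = a^[r] ++ gamma (last v (map qt a)) s :: l', chain v a &
        chain ((last v (map qt a), suc s) : qV H) l']].
Proof.
elim: l v r => [|b l IH] v r /=; first by move=> _; apply: Or31; exists [::].
case/andP; case: b => [[[a s]|[i s]]|j]; rewrite pair_eqE => /andP[/eqP ? /eqP ?]; subst.
- case/IH => [[a' -> ca]|[y [j [x [-> -> cy yj cx]]]]|[a' [s' [l' [-> -> ca cl]]]]].
  + by apply: Or31; exists (a :: a'); rewrite //= eqxx.
  + by apply: Or32; exists (a :: y), j, x; split; rewrite //= eqxx.
  + by apply: Or33; exists (a :: a'), s', l'; split; rewrite //= eqxx.
- by move=> cl; apply: Or33; exists [::], s, l.
- case/IH => [[a' -> ca]|[y [j' [x []]]]|[a' [s' [l' []]]]].
  + by apply: Or32; exists [::], j, a'.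
  + by move/(congr1 val).
  + by move/(congr1 val) => /= e; have := ltn_ord s'; rewrite -e ltnn.
Qed.

Definition strip (l : seq (qA H)) : seq (qA Q) :=
  pmap (fun b : mlA k Q m M => if b is inl (inl (a, _)) then Some a else None) l.
Definition gammas (l : seq (qA H)) : nat :=
  count (fun b : mlA k Q m M => if b is inl (inr _) then true else false) l.
Definition betas (l : seq (qA H)) : nat :=
  count (fun b : mlA k Q m M => if b is inr _ then true else false) l.

Lemma strip_cat l1 l2 : strip (l1 ++ l2) = strip l1 ++ strip l2.
Proof. exact: pmap_cat. Qed.
Lemma gammas_cat l1 l2 : gammas (l1 ++ l2) = (gammas l1 + gammas l2)%N.
Proof. exact: count_cat. Qed.
Lemma betas_cat l1 l2 : betas (l1 ++ l2) = (betas l1 + betas l2)%N.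
Proof. exact: count_cat. Qed.

Lemma strip_lift r l : strip l^[r] = l.
Proof. by elim: l => //= a l ->. Qed.
Lemma gammas_lift r l : gammas l^[r] = 0%N.
Proof. by elim: l. Qed.
Lemma betas_lift r l : betas l^[r] = 0%N.
Proof. by elim: l. Qed.

(** A [gamma] arrow keeps the vertex of [Q], so deleting it does not break the path; a [beta] arrow
    would. *)
Lemma chain_strip (v : qV H) l : betas l = 0%N -> chain v l ->
  chain v.1 (strip l) /\ last v.1 (map qt (strip l)) = (last v (map qt l)).1.
Proof.
elim: l v => //= -[[[a s]|[i s]]|j] l IH v //= bl /andP[/eqP <-] /(IH _ bl) //=.
by rewrite eqxx.
Qed.

Lemma ptgt_floor r (p : qpath Q) :
  ptgt (floor k Q m M r p : qpath H) = (ptgt p, r).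
Proof. exact: last_lift. Qed.

Lemma ev_floor (f : qpath H -> k) r (x : kQ Q) :
  ev f [seq (u.1, floor k Q m M r u.2) | u <- x] =
  ev (fun p => f (floor k Q m M r p)) x.
Proof. by rewrite /ev big_map. Qed.

Lemma ev_xby (f : qpath H -> k) (T : seq (k * qpath Q * 'I_(size M) * qpath Q)) :
  ev f [seq (w.1.1.1, xby k Q m M w.1.1.2 w.1.2 w.2) | w <- T] =
  \sum_(w <- T) w.1.1.1 * f (xby k Q m M w.1.1.2 w.1.2 w.2).
Proof. by rewrite /ev big_map. Qed.

Lemma ptgt_xby x j y :
  x.1 = (Mth M j).1 -> ptgt (xby k Q m M x j y : qpath H) = (ptgt x, top).
Proof.
move=> x1; rewrite /ptgt /= map_cat last_cat /= last_lift x1 //.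
Qed.

(* Projection of the summand [Lambda gamma] onto [Lambda]. *)
Definition proj (P : qpath H) : kQ Q :=
  if (betas P.2 == 0) && (gammas P.2 == 1) then [:: (1, (P.1.1, strip P.2))] else [::].

(** Sandwiches of the double [gamma] relations have too many [gamma] arrows and those of [rhoM]
    contain a [beta], so both project to 0. The two terms of a commutation relation have the same
    projection and cancel. A floor relation projects to a multiple of a sandwich of the original
    one. *)
Lemma in_ideal_proj x : in_ideal H x -> in_ideal Q (lin proj x).
Proof.
move: x; apply: in_ideal_lin => c u v x xr pu pv.
have coefP p : coef (lin proj (sandwich c u x v)) p =
    c * ev (fun a => if (ptgt v == a.1) && (ptgt a == u.1)
      then if (betas v.2 + (betas a.2 + betas u.2) == 0)%N &&
              (gammas v.2 + (gammas a.2 + gammas u.2) == 1)%N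
      then ((v.1.1, strip v.2 ++ strip a.2 ++ strip u.2) == p)%:R else 0 else 0) x.
  rewrite coefE ev_lin ev_sandwich; congr (_ * _); apply: eq_evr => a.
  case: ifP => // _; rewrite /proj /= !betas_cat !gammas_cat.
  by case: ifP => _; rewrite ?ev_nil // ev_cons ev_nil /= mul1r addr0 !strip_cat.
case: xr => [[r [y [yr def_x]]]|[[i [r def_x]]|[[a [r def_x]]|[T [_ _ _ def_x]]]]].
- have [[bv bu]|bvu] := classic (betas v.2 = 0%N /\ betas u.2 = 0%N); last first.
    apply: in_ideal_coef0 => p; rewrite coefP def_x ev_floor.
    rewrite [X in _ * X](_ : _ = 0) ?mulr0 //; apply: etrans (ev0 y); apply: eq_evr => a.
    case: ifP => // _; case: ifP => // /andP[].
    by rewrite !addn_eq0 => /and3P[/eqP ? _ /eqP ?] _; case: bvu.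
  have [cv ev_] := chain_strip bv pv; have [cu _] := chain_strip bu pu.
  (* The multiple is [c] when the floors of [u] and [v] fit and exactly one [gamma] occurs in them
     together, and 0 otherwise. *)
  pose d := if ((ptgt v).2 == r) && (u.1.2 == r) && (gammas v.2 + gammas u.2 == 1)%N
            then c else 0.
  apply: in_ideal_ext (@in_ideal_sandwich _ _ d (u.1.1, strip u.2) (v.1.1, strip v.2) _ yr cu cv) => p.
  rewrite coefP def_x ev_floor coefE ev_sandwich -!ev_mull; apply: eq_evr => a.
  rewrite ptgt_floor /= betas_lift gammas_lift bv bu strip_lift !addn0 !add0n /=.
  rewrite {1}/ptgt /= ev_ -/(ptgt v) /d.
  case: (ptgt v) => t1 t2; case: u {pu bu cu coefP d} => [[u1 u2] lu] /=.
  rewrite !pair_eqE.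
  rewrite [r == u2]eq_sym; case: (t2 == r); case: (u2 == r) => //=;
    rewrite ?andbF ?andbT ?mul0r ?mulr0 //.
  by case: (_ && _); case: (_ == 1%N); rewrite ?mul0r ?mulr0.
- apply: in_ideal_coef0 => p; rewrite coefP def_x ev_cons ev_nil /=.
  rewrite !addnS.
  by rewrite andbF if_same mulr0 addr0 mulr0.
- apply: in_ideal_coef0 => p; rewrite coefP def_x !ev_cons ev_nil /=.
  by rewrite addr0 mulN1r mul1r subrr mulr0.
- apply: in_ideal_coef0 => p; rewrite coefP def_x ev_xby big1 ?mulr0 // => w _.
  by rewrite /= betas_cat /= ?add1n !(addnS, addSn) /= if_same mulr0.
Qed.

Lemma bound_of_strip (P : qpath H) : is_path P ->
  betas P.2 = 0%N -> gammas P.2 = 1%N -> ~ in_ideal Q [:: (1, (P.1.1, strip P.2))] ->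
  bound_path H P.
Proof.
move=> pP bP gP nI; split=> // /in_ideal_proj PI; apply: nI; apply: in_ideal_ext PI => p.
by rewrite !coefE ev_lin !ev_cons !ev_nil /proj bP gP /= !ev_cons !ev_nil !mul1r !addr0.
Qed.

(* With [post := fun=> [::]] this embeds a floor; with [post i := [:: gamma i s]]
   it is floor [r] followed by a vertical arrow. *)
Lemma in_ideal_lift r (post : qV Q -> seq (qA H)) p :
  (forall i, chain ((i, r) : qV H) (post i)) ->
  is_bound_quiver Q -> in_ideal Q [:: (1, p)] ->
  in_ideal H [:: (1, (((p.1, r) : qV H), p.2^[r] ++ post (ptgt p)))].
Proof.
move=> cpost bQ pI.
pose F (q : qpath Q) : kQ H := [:: (1, (((q.1, r) : qV H), q.2^[r] ++ post (ptgt q)))].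
have: in_ideal H (lin F [:: (1, p)]).
  apply: in_ideal_lin pI => c u v x xr pu pv.
  have xr' : qrel H [seq (w.1, floor k Q m M r w.2) | w <- x] by left; exists r, x.
  have pv' : is_path (((v.1, r), v.2^[r]) : qpath H) by rewrite /is_path chain_lift.
  have pu' : is_path (((u.1, r), u.2^[r] ++ post (ptgt u)) : qpath H).
    by rewrite /is_path chain_cat chain_lift last_lift cpost andbT.
  apply: in_ideal_ext (in_ideal_sandwich c xr' pu' pv') => q.
  rewrite !coefE ev_lin !ev_sandwich ev_floor; congr (_ * _); apply: eq_evr => a.
  rewrite ptgt_floor /= {1}/ptgt last_lift /= !pair_eqE !eqxx !andbT -/(ptgt v).
  case: andP => // -[/eqP va /eqP au]; rewrite /F ev_cons ev_nil mul1r addr0 /=.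
  congr (_ == _)%:R; congr (_, _); rewrite !lift_seq_cat -!catA.
  by rewrite /ptgt /= !map_cat !last_cat -/(ptgt v) va -/(ptgt a) au.
apply: in_ideal_ext => q.
by rewrite !coefE ev_lin !ev_cons !ev_nil /= !mul1r !addr0.
Qed.

(** The [gamma] moves past one horizontal arrow at a time by a commutation relation; the arrow just
    passed joins [pre], now one floor lower. *)
Lemma gamma_comm (v : qV H) pre (i : qV Q) (s : 'I_m.+1) b post :
  chain v (pre ++ gamma i s :: b^[suc s] ++ post) ->
  in_ideal H [:: (1, (v, pre ++ gamma i s :: b^[suc s] ++ post));
                 (-1, (v, pre ++ b^[wid s] ++ gamma (last i (map qt b)) s :: post))].
Proof.
elim: b pre i => [|a b IH] pre i /=.
  move=> _; apply: in_ideal_coef0 => p.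
  by rewrite coefE !ev_cons ev_nil mul1r mulN1r addr0 subrr.
rewrite chain_cat /= !pair_eqE eqxx andbT => /and4P[cpre /eqP def_v /eqP def_i cpost].
have step : in_ideal H [:: (1, (v, pre ++ gamma i s :: alpha a (suc s) :: b^[suc s] ++ post));
    (-1, (v, pre ++ alpha a (wid s) :: gamma (qt a) s :: b^[suc s] ++ post))].
  have xr : qrel H [:: (1, ((qs a, wid s), [:: gamma (qs a) s; alpha a (suc s)]));
      (-1, ((qs a, wid s), [:: alpha a (wid s); gamma (qt a) s]))].
    by right; right; left; exists a, s.
  apply: in_ideal_ext (@in_ideal_sandwich _ H 1 ((qt a, suc s), b^[suc s] ++ post)
     (v, pre) _ xr cpost cpre) => p.
  rewrite !coefE ev_sandwich !ev_cons !ev_nil mul1r /= /ptgt /= -def_v def_i.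
  by rewrite !pair_eqE !eqxx.
have /IH IHb : chain v ((rcons pre (alpha a (wid s))) ++ gamma (qt a) s :: b^[suc s] ++ post).
  rewrite cat_rcons chain_cat /= cpre -def_v def_i !pair_eqE !eqxx /=.
  by move: cpost; rewrite !chain_cat.
apply: in_ideal_ext (in_ideal_cat step IHb) => p.
rewrite !cat_rcons !coefE ev_cat !ev_cons !ev_nil /= !mul1r !mulN1r !addr0.
by rewrite addrA addrNK.
Qed.

(** Commuting the first [gamma] past [b] makes the two adjacent, and their product is a relation. *)
Lemma gamma_gamma (v : qV H) pre (i j : qV Q) (s t : 'I_m.+1) b post :
  wid t = suc s -> j = last i (map qt b) ->
  chain v (pre ++ gamma i s :: b^[suc s] ++ gamma j t :: post) ->
  in_ideal H [:: (1, (v, pre ++ gamma i s :: b^[suc s] ++ gamma j t :: post))].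
Proof.
move=> ts -> cP; apply: in_ideal_trans (gamma_comm cP) _.
have vts : t = s.+1 :> nat by move/(congr1 val): ts.
have lt_sm : (s < m)%N by rewrite -ltnS -vts ltn_ord.
set j' := last i _; have xr : qrel H [:: (1, ((j', wid s), [:: gamma j' s; gamma j' t]))].
  (* These relations are indexed by ['I_m]; the index is legal because [t] is [s + 1] and lies below
     [m + 1]. *)
  right; left; exists j', (Ordinal lt_sm).
  have es : widen_ord (leqnSn m) (Ordinal lt_sm) = s by apply: val_inj.
  have et : lift ord0 (Ordinal lt_sm) = t by apply: val_inj; apply: esym vts.
  by rewrite es et.
move: cP; rewrite chain_cat /= chain_cat last_lift chain_lift /= !pair_eqE.
move=> /and5P[cpre /eqP def_v cb _ cpost].
have cv : is_path ((v, pre ++ b^[wid s]) : qpath H).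
  by rewrite /is_path /= chain_cat cpre -def_v chain_lift.
apply: in_ideal_ext (@in_ideal_sandwich _ H 1 ((j', suc t), post) _ _ xr cpost cv) => p.
rewrite !coefE ev_sandwich !ev_cons !ev_nil mul1r /= /ptgt /=.
by rewrite map_cat last_cat -def_v last_lift !pair_eqE !eqxx /= -catA.
Qed.


Lemma in_ideal_mlrel x : is_bound_quiver H -> qrel H x -> in_ideal H x.
Proof.
move=> bH xr; have [s [t [L [_ st]]]] := bH x xr.
by apply: (in_ideal_qrel xr (s := s) (t := t)) => p /st[].
Qed.

Lemma path_xby (x : qpath Q) j (y : qpath Q) : is_path x -> is_path y ->
  ptgt y = ptgt (Mth M j) -> x.1 = (Mth M j).1 ->
  is_path (xby k Q m M x j y : qpath H).
Proof.
move=> px py yj xj; rewrite /is_path /= chain_cat chain_lift last_lift /=.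
by rewrite -/(ptgt y) yj !eqxx -xj chain_lift; apply/andP.
Qed.

(** * The multi-layer quiver over a basis is a nicely-graded bound quiver whose maximal bound paths
    have length [m + 1] *)

Section Basis.
Hypotheses (bQ : is_bound_quiver Q) (gQ : nicely_graded_m Q m) (bM : ml_basis Q m M).

Let pathM j : is_path (Mth M j).
Proof. by case: bM => [/(_ j)[[[]]]]. Qed.
Let lenM j : plen (Mth M j) = m.
Proof. by case: bM => [/(_ j)[]]. Qed.
Let indepM (a : 'I_(size M) -> k) : in_ideal Q (comb a) -> forall i, a i = 0.
Proof. by case: bM => [_ [_]]; apply. Qed.

(** The delicate case is [rhoM], whose elements live in length [L + 1], where [L] is the total
    length of [x] and [y]. For [L = 0] this would be 1, but then the element is a combination of
    bare [beta] arrows, and independence of the dual functionals makes all its coefficients 0. *)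
Lemma multilayer_bound : is_bound_quiver H.
Proof.
move=> x [[r [y [yr ->]]]|[[i [r ->]]|[[a [r ->]]|[T [T1 [s [t [L T2]]] T3 ->]]]]].
- have [s [t [L [L2 yL]]]] := bQ yr; exists (s, r), (t, r), L; split=> // P.
  rewrite coefE ev_floor => /ev_neq0[p /yL[pp ps pt pl]].
  case: (_ =P P) => [<- _|_]; last by rewrite eqxx.
  split; [by rewrite /is_path chain_lift | by rewrite /= ps
         | by rewrite ptgt_floor pt | by rewrite /plen size_map].
- exists (i, wid (widen_ord (leqnSn _) r)), (i, suc (lift ord0 r)), 2; split=> // P.
  rewrite coefE ev_cons ev_nil mul1r addr0; case: (_ =P P) => [<- _|_]; last by rewrite eqxx.
  split=> //; rewrite /is_path /= !pair_eqE !eqxx /= andbT.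
  exact/eqP/val_inj.
- exists (qs a, wid r), (qt a, suc r), 2; split=> // P.
  rewrite coefE !ev_cons ev_nil mul1r mulN1r addr0 /=.
  case: (_ =P P) => [<- _|_]; last (case: (_ =P P) => [<- _|_]; last by rewrite subrr eqxx).
    by split=> //; rewrite /is_path /= !pair_eqE !eqxx.
  by split=> //; rewrite /is_path /= !pair_eqE !eqxx.
have supp P : coef ([seq (w.1.1.1, xby k Q m M w.1.1.2 w.1.2 w.2) | w <- T] : kQ H) P != 0 ->
    exists2 w, w \in T & xby k Q m M w.1.1.2 w.1.2 w.2 = P.
  move=> nz; apply: NNPP => nT; case/eqP: nz; rewrite coefE ev_xby big_seq big1 // => w wT.
  by case: (_ =P P) => [wP|_]; [case: nT; exists w | rewrite mulr0].
exists (s, ord0), (t, top); case: L T2 => [|L] T2; last first.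
  exists L.+2; split=> // P /supp[w wT <-].
  have [px py yj xj] := T1 w wT; have [ys xt len] := T2 w wT.
  rewrite ptgt_xby // path_xby // xt /= ys; split=> //.
  by rewrite /plen /= size_cat /= !size_map addnS addnC -len.
exists 2; split=> // P nz; case/eqP: (nz); have [w0 w0T wP] := supp P nz.
have [phi dual] : exists phi, is_dual Q m M phi by case: bM => _ [].
have triv w : w \in T -> [/\ w.1.1.2 = ((Mth M w.1.2).1, [::]) &
                            w.2 = (ptgt (Mth M w.1.2), [::])].
  move=> wT; have [_ _ yj xj] := T1 w wT; have [_ _ /eqP] := T2 w wT.
  rewrite addn_eq0 -yj -xj; case: (w.1.1.2) (w.2) => [x1 x2] [y1 y2] /=.
  by case/andP=> /nilP /= -> /nilP /= ->.
(* The coefficient of [P] is the defining sum of [rhoM] tested at the basis path of [w0]. *)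
rewrite coefE ev_xby -{2}(T3 phi dual _ (pathM w0.1.2)) big_seq [RHS]big_seq.
apply: eq_bigr => w wT; congr (_ * _); rewrite -wP.
have [-> ->] := triv w wT; have [-> ->] := triv w0 w0T; rewrite /xby /= cats0 /ptgt /=.
rewrite -!/(ptgt _); case: ifP => [/andP[/eqP e1 /eqP e2]|ne].
  rewrite e1 -surjective_pairing (dual_basis _ indepM dual) //.
  congr (_)%:R; congr nat_of_bool; apply/eqP/eqP => [[_ ->] //|->//].
case: eqP => // -[_ ej]; case/negP: (negbT ne).
by rewrite ej !eqxx.
Qed.

(** The grade is that of [Q] plus the floor number. Along a [beta] the former drops by [m] and the
    latter rises by [m + 1]. *)
Lemma multilayer_nicely_graded : nicely_graded H.
Proof.
have [_ [u uQ]] := gQ; exists (fun v : qV H => u v.1 + (val v.2)%:Z).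
move=> [[[a r]|[i r]]|j] /=.
- by rewrite uQ addrAC.
- by rewrite /bump /= -addrA -PoszD addn1 add1n.
- by rewrite (path_grade uQ (pathM j)) lenM addr0 -addrA -PoszD addn1.
Qed.

(** The horizontal arrows met before the [beta] accumulate in [pre]; at the [beta] its dual
    functional is applied to the path that runs through the later arrows first and then through
    [pre]. *)
Fixpoint theta (phi : 'I_(size M) -> qpath Q -> k) (pre : seq (qA Q))
    (l : seq (mlA k Q m M)) : k :=
  match l with
  | [::] => 0
  | inl (inl (a, _)) :: l' => theta phi (rcons pre a) l'
  | inl (inr _) :: _ => 0
  | inr j :: l' => phi j ((Mth M j).1, strip l' ++ pre)
  end.

(* The functional [x beta_f y |-> (x f^* y)(1)] on the summand [D Lambda]. *)
Definition trace phi (P : qpath H) : k :=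
  if [&& gammas P.2 == 0, betas P.2 == 1 & (ptgt P).1 == P.1.1]%N
  then theta phi [::] P.2 else 0.

Lemma theta_lift phi pre a r l : theta phi pre (a^[r] ++ l) = theta phi (pre ++ a) l.
Proof.
by elim: a pre => [|a l' IH] pre /=; rewrite ?cats0 // IH cat_rcons.
Qed.

Lemma trace_gamma phi (P : qpath H) : (0 < gammas P.2)%N -> trace phi P = 0.
Proof. by rewrite /trace; case: gammas. Qed.

Lemma trace_beta phi (P : qpath H) : betas P.2 != 1%N -> trace phi P = 0.
Proof. by rewrite /trace andbCA => /negbTE->. Qed.

Lemma trace_xby phi (v : qV Q) r s y j x :
  trace phi (((v, r), y^[s] ++ beta j :: x^[top]) : qpath H) =
  if last (Mth M j).1 (map qt x) == v then phi j ((Mth M j).1, x ++ y) else 0.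
Proof.
rewrite /trace /= gammas_cat betas_cat /= !gammas_lift !betas_lift /=.
by rewrite /ptgt /= map_cat last_cat /= last_lift theta_lift /= strip_lift.
Qed.

Lemma dual_sandwich phi (u v : qpath Q) x i : is_dual Q m M phi -> qrel Q x ->
  is_path u -> is_path v -> ev (phi i) (sandwich 1 u x v) = 0.
Proof.
move=> dual xr pu pv; have [L xL] := coef_sandwich_path 1 bQ xr pu pv.
exact: (dual_ideal i indepM dual xL (in_ideal_sandwich 1 xr pu pv)).
Qed.

(** The trace sees a path only up to rotation. Cutting the closed-up path at its [beta] turns the
    sandwich into one in [Q], on which the dual functional vanishes. If the total number of [beta]
    arrows is not one, if a [gamma] occurs, or if the projected ends differ, every trace is 0. *)
Lemma trace_floor phi (u v : qpath H) r y : is_dual Q m M phi -> qrel Q y ->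
  is_path u -> is_path v ->
  ev (trace phi) (sandwich 1 u [seq (w.1, floor k Q m M r w.2) | w <- y] v) = 0.
Proof.
move=> dual yr; case: u v => [[u0 ru] lu] [[v0 rv] lv] pu pv.
rewrite ev_sandwich mul1r ev_floor.
case: (multilayer_path_cases pv) => [[A deflv cA]|[yy [j [xx [rv0 deflv cy yj cx]]]]|
  [A [s [l' [_ deflv _ _]]]]]; move: deflv => /= ?; subst lv; last first.
- apply: ev_supp0 => p _; rewrite trace_gamma ?if_same //=.
  by rewrite !gammas_cat /= add1n !(addnS, addSn).
- case: (multilayer_path_cases pu) => [[B deflu cB]|[yy' [j' [xx' [_ deflu _ _ _]]]]|
    [B [s [l' [_ deflu _ _]]]]]; move: deflu => /= ?; subst lu; last first.
  + apply: ev_supp0 => p _; rewrite trace_gamma ?if_same //=.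
    by rewrite !gammas_cat /= add1n !(addnS, addSn).
  + apply: ev_supp0 => p _; rewrite trace_beta ?if_same //=.
    by rewrite !betas_cat /= !add1n !(addnS, addSn).
  have ptgt_v : ptgt (((v0, rv), yy^[ord0] ++ beta j :: xx^[top]) : qpath H) =
      (last (Mth M j).1 (map qt xx), top).
    by rewrite /ptgt /= map_cat last_cat /= last_lift.
  (* The [beta] precedes the relation: from the source of the basis path one runs through [xx], the
     relation, [B], and then [yy]. *)
  have [[[? ?] Bv]|ne] := classic ((r = top /\ ru = top) /\ last u0 (map qt B) = v0).
    subst r ru; apply: etrans (@dual_sandwich phi (u0, B ++ yy) ((Mth M j).1, xx) y j
      dual yr _ cx); last by rewrite /is_path /= chain_cat cB Bv.
    rewrite ev_sandwich mul1r; apply: eq_evr => p.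
    rewrite ptgt_v ptgt_floor /= !pair_eqE !eqxx !andbT.
    case: ifP => // /andP[/eqP e1 /eqP e2].
    rewrite -catA cat_cons -!lift_seq_cat trace_xby -!catA.
    by rewrite !map_cat !last_cat e1 -/(ptgt p) e2 Bv eqxx.
  apply: ev_supp0 => p _; rewrite ptgt_v ptgt_floor /= !pair_eqE.
  case: ifP => // /andP[/andP[/eqP e1 /eqP ?] /andP[/eqP e2 /eqP ?]]; subst ru r.
  rewrite -catA cat_cons -!lift_seq_cat trace_xby.
  by rewrite !map_cat !last_cat e1 -/(ptgt p) e2; case: eqP => // Bv; case: ne.
- case: (multilayer_path_cases pu) => [[B deflu cB]|[yy [j [xx [ru0 deflu cy yj cx]]]]|
    [B [s [l' [_ deflu _ _]]]]]; move: deflu => /= ?; subst lu; last first.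
  + apply: ev_supp0 => p _; rewrite trace_gamma ?if_same //=.
    by rewrite !gammas_cat /= add1n !(addnS, addSn).
  + subst ru.
    (* The [beta] follows the relation: one runs through [xx], [A], the relation, and then [yy]. *)
    have [[[? ?] xv]|ne] := classic ((r = ord0 /\ rv = ord0) /\
        last (Mth M j).1 (map qt xx) = v0).
      subst r rv; apply: etrans (@dual_sandwich phi (u0, yy) ((Mth M j).1, xx ++ A) y j
        dual yr cy _); last by rewrite /is_path /= chain_cat cx xv.
      rewrite ev_sandwich mul1r; apply: eq_evr => p.
      have ->: ptgt (((Mth M j).1, xx ++ A) : qpath Q) = last v0 (map qt A).
        by rewrite /ptgt /= map_cat last_cat xv.
      rewrite ptgt_floor ptgt_lift /= !pair_eqE !eqxx !andbT; case: ifP => // _.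
      by rewrite !catA -!lift_seq_cat trace_xby xv eqxx !catA.
    apply: ev_supp0 => p _; rewrite ptgt_floor ptgt_lift !pair_eqE.
    case: ifP => // /andP[/andP[_ /eqP ?] /andP[_ /eqP ?]]; subst rv r.
    by rewrite !catA -!lift_seq_cat trace_xby; case: eqP => // xv; case: ne.
  + apply: ev_supp0 => p _; rewrite trace_beta ?if_same //=.
    by rewrite !betas_cat !betas_lift.
Qed.

(** With horizontal [A] before and [B] after, rotation makes the trace the value of the defining sum
    of [rhoM] at the path [z] that runs through [B] and then [A], and this value is 0. *)
Lemma trace_rhoM phi (u v : qpath H) x : is_dual Q m M phi -> rhoM k Q m M x ->
  is_path u -> is_path v -> ev (trace phi) (sandwich 1 u x v) = 0.
Proof.
move=> dual [T [T1 _ T3 ->]]; case: u v => [[u0 ru] lu] [[v0 rv] lv] pu pv.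
rewrite ev_sandwich mul1r ev_xby.
case: (multilayer_path_cases pv) => [[A deflv cA]|[yy [j [xx [_ deflv _ _ _]]]]|
  [A [s [l' [_ deflv _ _]]]]]; move: deflv => /= ?; subst lv; last first.
- rewrite big1 // => w _; rewrite trace_gamma ?if_same ?mulr0 //=.
  by rewrite !gammas_cat /= add1n !(addnS, addSn).
- rewrite big1 // => w _; rewrite trace_beta ?if_same ?mulr0 //=.
  by rewrite !betas_cat /= !add1n !(addnS, addSn).
case: (multilayer_path_cases pu) => [[B deflu cB]|[yy [j [xx [_ deflu _ _ _]]]]|
  [B [s [l' [_ deflu _ _]]]]]; move: deflu => /= ?; subst lu; last first.
- rewrite big1 // => w _; rewrite trace_gamma ?if_same ?mulr0 //=.
  by rewrite !gammas_cat /= !add1n !(addnS, addSn).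
- rewrite big1 // => w _; rewrite trace_beta ?if_same ?mulr0 //=.
  by rewrite !betas_cat /= !add1n !(addnS, addSn).
have traceE (w : k * qpath Q * 'I_(size M) * qpath Q) : w.1.1.2.1 = (Mth M w.1.2).1 ->
    ptgt w.1.1.2 = u0 ->
    trace phi (((v0, ord0), A^[ord0] ++
       ([seq alpha a ord0 | a <- w.2.2] ++
        beta w.1.2 :: [seq alpha a top | a <- w.1.1.2.2]) ++ B^[top]) : qpath H) =
    if last u0 (map qt B) == v0 then
      phi w.1.2 (w.1.1.2.1, w.1.1.2.2 ++ (B ++ A) ++ w.2.2) else 0.
  move=> x1 xt; rewrite -!/(lift_seq _ _) -catA cat_cons [A^[_] ++ _]catA -!lift_seq_cat.
  by rewrite trace_xby -x1 map_cat last_cat -/(ptgt w.1.1.2) xt !catA.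
have [[[? ?] Bv]|ne] := classic ((rv = ord0 /\ ru = top) /\ last u0 (map qt B) = v0).
  subst rv ru; have cz : is_path ((u0, B ++ A) : qpath Q).
    by rewrite /is_path /= chain_cat Bv cB.
  rewrite -[RHS](T3 phi dual _ cz) big_seq [RHS]big_seq; apply: eq_bigr => w wT.
  congr (_ * _); have [px py yj xj] := T1 w wT.
  have ->: ptgt ((u0, B ++ A) : qpath Q) = last v0 (map qt A).
    by rewrite /ptgt /= map_cat last_cat Bv.
  rewrite ptgt_lift ptgt_xby // !pair_eqE !eqxx !andbT andbC /=.
  by case: ifP => // /andP[/eqP xt _]; rewrite traceE // Bv eqxx.
rewrite big_seq big1 // => w wT; have [px py yj xj] := T1 w wT.
rewrite ptgt_lift ptgt_xby // !pair_eqE.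
case: ifP => [/andP[/andP[_ /eqP ?] /andP[/eqP xt /eqP ?]]|_]; last by rewrite mulr0.
subst rv ru; rewrite traceE //; case: eqP => [Bv|_]; last by rewrite mulr0.
by case: ne.
Qed.

Lemma trace_ideal phi x : is_dual Q m M phi -> in_ideal H x -> ev (trace phi) x = 0.
Proof.
move=> dual; move: x; apply: ev_ideal0 => c u v x xr pu pv.
rewrite -[c]mulr1 [sandwich _ _ _ _](_ : _ = [seq (c * w.1, w.2) | w <- sandwich 1 u x v]).
  rewrite ev_scale; suff ->: ev (trace phi) (sandwich 1 u x v) = 0 by rewrite mulr0.
  case: xr => [[r [y [yr ->]]]|[[i [r ->]]|[[a [r ->]]|xr]]].
  - exact: trace_floor.
  - rewrite ev_sandwich mul1r ev_cons ev_nil trace_gamma ?if_same ?mulr0 ?addr0 //=.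
    by rewrite !gammas_cat /= !add1n !(addnS, addSn).
  - rewrite ev_sandwich mul1r !ev_cons ev_nil !trace_gamma ?if_same ?mulr0 ?addr0 //=.
      by rewrite !gammas_cat /= !add1n !(addnS, addSn).
    by rewrite !gammas_cat /= !add1n !(addnS, addSn).
  - exact: trace_rhoM.
by rewrite /sandwich -map_comp; apply: eq_map => w /=; rewrite mul1r mulr1.
Qed.

Lemma multilayer_properly_graded : properly_graded H m.+1.
Proof.
move=> [[v r] l] [[pP nI] maxP].
case: (multilayer_path_cases pP) => [[a defl ca]|[y [j [x [r0 defl cy yj cx]]]]|
  [a [s [l1 [rs defl ca cl1]]]]]; move: defl => /= ?; subst l.
(* A path on a single floor is bound in [Q] too. It stays bound when a [gamma] is appended, or
   prepended on the top floor where none starts, so it is not maximal. *)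
- have npI : ~ in_ideal Q [:: (1, (v, a))].
    move=> aI; apply: nI; have := @in_ideal_lift r (fun=> [::]) (v, a) (fun=> isT) bQ aI.
    by rewrite cats0.
  have [lt_r|] := ltnP r m.+1.
    have rE : r = wid (Ordinal lt_r) by apply: val_inj.
    have [|//|//|_ //] := maxP ((v, r), a^[r] ++ [:: gamma (last v (map qt a)) (Ordinal lt_r)])
      [::] [:: gamma (last v (map qt a)) (Ordinal lt_r)].
    apply: bound_of_strip; rewrite /= ?betas_cat ?gammas_cat ?betas_lift ?gammas_lift //.
      by rewrite /is_path chain_cat chain_lift last_lift ca /= pair_eqE -rE !eqxx.
    by rewrite strip_cat strip_lift cats0.
  rewrite leq_eqVlt ltnNge -ltnS ltn_ord orbF => /eqP rm.
  have rE : r = suc ord_max by apply: val_inj; rewrite /= /bump /= add1n.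
  have [|//|//|//] := maxP ((v, wid ord_max), gamma v ord_max :: a^[r]) [:: gamma v ord_max] [::].
  + apply: bound_of_strip; rewrite /= ?betas_lift ?gammas_lift ?strip_lift //.
    by rewrite /is_path /= pair_eqE !eqxx /= rE chain_lift.
  + by rewrite cats0.
  + by rewrite /= rE.
- subst r.
  (* If no dual family and path [z] gave a nonzero value, the single path itself would belong to
     [rhoM] and hence to the ideal. *)
  have [phi [z [dual [pz nz]]]] : exists phi z, [/\ is_dual Q m M phi, is_path z &
      (if (last (Mth M j).1 (map qt x) == z.1) && (ptgt z == v)
       then phi j ((Mth M j).1, x ++ z.2 ++ y) else 0) != 0].
    apply: NNPP => nex; apply: nI; apply: in_ideal_mlrel multilayer_bound _.
    right; right; right; exists [:: (1, ((Mth M j).1, x), j, (v, y))]; split=> //.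
    + by move=> w; rewrite inE => /eqP->.
    + exists v, (last (Mth M j).1 (map qt x)), (size x + size y)%N => w.
      by rewrite inE => /eqP->.
    + move=> phi dual z pz; rewrite big_cons big_nil mul1r addr0 /=.
      by apply: NNPP => /eqP nz; apply: nex; exists phi, z.
  move: nz; case: ifP => [/andP[/eqP xz /eqP zv] nz|_]; last by rewrite eqxx.
  have lz : (size x + (size z.2 + size y))%N = m.
    apply: NNPP => ne; case/eqP: nz; case: dual => _; apply.
      by rewrite /is_path /= !chain_cat cx xz -/(ptgt z) zv /=; apply/andP.
    by rewrite /plen /= !size_cat.
  (* Appending [z] on the top floor keeps the trace nonzero, so the longer path is bound and
     maximality makes [z] trivial. Then [x] and [y] have total length [m], and the [beta] adds 1. *)
  have [|||_ z0] := maxP ((v, ord0), y^[ord0] ++ beta j :: (x ++ z.2)^[top]) [::] z.2^[top].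
  + split; first by apply: (@path_xby ((Mth M j).1, x ++ z.2) j (v, y)); rewrite // /is_path /= chain_cat cx xz.
    move/(trace_ideal dual); rewrite ev_cons ev_nil mul1r addr0 trace_xby.
    rewrite map_cat last_cat xz -/(ptgt z) zv eqxx -catA; exact/eqP.
  + by rewrite /= lift_seq_cat -catA.
  + by [].
  move: z0 lz; case: (z.2) => // _ lz.
  by rewrite /plen /= size_cat /= !size_map addnS addnC -[RHS](congr1 succn lz).
- subst r; set i := last v (map qt a) in pP nI maxP cl1 *.
  case: (multilayer_path_cases cl1) => [[b defl cb]|[y [j [x [r0 _ _ _ _]]]]|
    [b [t [l2 [rt defl cb cl2]]]]]; last first.
  (* A second [gamma] would make the path vanish; a [beta] is excluded next, since the floor after a
     [gamma] is not 0. *)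
  + by case: nI; rewrite defl; apply: gamma_gamma; rewrite // -defl.
  + by move/(congr1 val): r0.
  subst l1.
  have mp : maximal_bound_path Q (v, a ++ b).
    split.
      split; first by rewrite /is_path /= chain_cat ca.
      move=> abI; apply: nI; have cP : chain ((v, wid s) : qV H)
          (* Move the [gamma] to the end: if the projection were 0 in [Q], its lift to one floor
             followed by [gamma] would be 0 as well. *)
          (a^[wid s] ++ gamma i s :: b^[suc s] ++ [::]) by rewrite cats0.
      have := gamma_comm cP; rewrite cats0 => /in_ideal_trans; apply.
      have := @in_ideal_lift (wid s) (fun i => [:: gamma i s]) _ _ bQ abI.
      rewrite /ptgt /= map_cat last_cat lift_seq_cat -catA; apply => i'.
      by rewrite /= pair_eqE !eqxx.
    move=> [q0 ql] l1 l2 [pq nq] /= ? qv; subst ql.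
    (* An extension of the projection lifts with [l1] on the floor before the [gamma] and [l2] on
       the floor after it. *)
    have [|||] := maxP ((q0, wid s), l1^[wid s] ++ (a^[wid s] ++ gamma i s :: b^[suc s]) ++ l2^[suc s])
      l1^[wid s] l2^[suc s].
    * apply: bound_of_strip.
      - rewrite /is_path chain_cat chain_lift last_lift qv chain_cat.
        move: pq; rewrite /is_path /= chain_cat qv chain_cat map_cat last_cat => /and3P[-> _ cl2].
        rewrite (pP : chain _ _) map_cat last_cat last_lift /= last_lift chain_lift.
        exact: cl2.
      - by rewrite /= !betas_cat /= !betas_lift.
      - by rewrite /= !gammas_cat /= !gammas_lift.
      - by rewrite /= !strip_cat /= !strip_lift.
    * by [].
    * by rewrite /= last_lift qv.
    by case: (l1) (l2) => [|? ?] [|? ?].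
  have := gQ.1 _ mp; rewrite /plen /= !size_cat /= !size_map addnS => ->.
  by [].
Qed.

End Basis.
End MultiLayerTheory.

(** * Iterating the construction *)

Section Iteration.
Variables (k : fieldType) (Q : bquiver k) (n : nat).

(** One basis is fixed by choice for every quiver and degree, so that the sequence is a plain
    recursion; the empty list only witnesses inhabitation. *)
Definition some_basis (Q' : bquiver k) (m : nat) : seq (qpath Q') :=
  epsilon (inhabits [::]) (ml_basis Q' m).

Fixpoint iter_multilayer (t : nat) : bquiver k :=
  if t is t'.+1 then
    multilayer (iter_multilayer t') (n + t') (some_basis (iter_multilayer t') (n + t'))
  else Q.

Lemma some_basisP Q' m : nicely_graded_m Q' m -> ml_basis Q' m (some_basis Q' m).
Proof. by move/ml_basis_exists; apply: epsilon_spec. Qed.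

(** Both properties are carried together: the grading provides a basis, and homogeneous relations
    make its dual functionals vanish on the ideal, as the next step requires. *)
Lemma iter_multilayer_graded t : is_bound_quiver Q -> nicely_graded_m Q n ->
  is_bound_quiver (iter_multilayer t) /\ nicely_graded_m (iter_multilayer t) (n + t).
Proof.
move=> bQ gQ; elim: t => [|t [bt gt]] /=; first by rewrite addn0.
have bM := some_basisP gt; split; first exact: multilayer_bound.
by rewrite addnS; split; [apply: multilayer_properly_graded | apply: multilayer_nicely_graded].
Qed.

End Iteration.

Theorem theorem5p6 (k : fieldType) (Q : bquiver k) (n : nat) :
  is_bound_quiver Q -> nicely_graded_m Q n ->
  exists Qs : nat -> bquiver k,
    Qs 0 = Q /\
    forall t : nat,
      [/\ is_bound_quiver (Qs t),
          nicely_graded_m (Qs t) (n + t) &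
          exists M : seq (qpath (Qs t)),
            ml_basis (Qs t) (n + t) M /\
            Qs t.+1 = multilayer (Qs t) (n + t) M].
Proof.
move=> bQ gQ; exists (iter_multilayer Q n); split=> // t.
have [bt gt] := iter_multilayer_graded t bQ gQ; split=> //.
by exists (some_basis (iter_multilayer Q n t) (n + t)); split; first exact: some_basisP.
Qed.
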